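(* For $\alpha>0$ and $A(z),B(z)\in\mathbb{C}[z]$, let $\{H_m^{(\alpha)}(z)\}_{m=0}^\infty$ be the sequence of polynomials generated by $$\sum_{m=0}^{\infty}H_m^{(\alpha)}(z)t^m=\frac{1}{(1+B(z)t+A(z)t^3)^{\alpha}}.$$ Then for all $m$ sufficiently large, the zeros of $H_m^{(\alpha)}(z)$ lie on the curve defined by $$\operatorname{Im}\frac{B^3(z)}{A(z)}=0\qquad\text{and}\qquad 0<-\operatorname{Re}\frac{B(z)^3}{A(z)}<\frac{27}{4}.$$
   Context: The generating function is understood as a power series in $t$ near $t=0$, with the principal branch of the power (equal to $1$ at $t=0$); each coefficient $H_m^{(\alpha)}(z)$ is a polynomial in $z$.
   Formalization: The formal theorem concerns only zeros of H_m with B(z) ≠ 0; zeros of B can be zeros of H_m (e.g. A = 1, B = z, z = 0, 3 not dividing m), where B³/A is 0 or undefined and the strict inequality fails. *)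

(* Defs.v *)
From HB Require Import structures.
From mathcomp Require Import all_boot all_order all_algebra.
From mathcomp Require Import all_classical all_reals all_analysis.
From mathcomp Require Export complex.

Set Implicit Arguments.
Unset Strict Implicit.
Unset Printing Implicit Defensive.

Import Order.TTheory GRing.Theory Num.Theory.
Import numFieldNormedType.Exports.

Local Open Scope classical_set_scope.
Local Open Scope ring_scope.
Local Open Scope complex_scope.

(* For R : realType the complex numbers are R[i]; the topology of the modulus is
   carried by the alias R[i]^o. *)

Definition cabs (R : realType) (w : R[i]) : R := complex.Re `|w|.

(* Principal argument, in ]-pi, pi] for w != 0. *)
Definition carg (R : realType) (w : R[i]) : R :=
  let theta := acos (complex.Re w / cabs w) in
  if 0 <= complex.Im w then theta else - theta.

Definition cexp (R : realType) (w : R[i]) : R[i] :=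
  (expR (complex.Re w))%:C * (cos (complex.Im w) +i* sin (complex.Im w)).

Definition clog (R : realType) (w : R[i]) : R[i] := ln (cabs w) +i* carg w.

(* Principal branch of w ^ a. It is only used for w near 1; the value at w = 0
   is junk. *)
Definition cpow (R : realType) (w : R[i]) (a : R) : R[i] :=
  cexp (a%:C * clog w).

(* The neighbourhood of t = 0 on which the expansion holds may depend on z. *)
Definition generated_by (R : realType) (alpha : R) (A B : {poly R[i]})
    (H : nat -> {poly R[i]}) : Prop :=
  forall z : R[i], \forall t \near (0 : R[i]^o),
    series (fun m => (H m).[z] * t ^+ m) @ \oo -->
      ((cpow (1 + B.[z] * t + A.[z] * t ^+ 3) alpha)^-1 : R[i]^o).

(* Points where A vanishes are excluded since B ^ 3 / A is undefined there
   (division by 0 is total here). The zeros of B are not on the curve: where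
   A is nonzero they give B ^ 3 / A = 0, the excluded endpoint. *)
Definition root_curve (R : realType) (A B : {poly R[i]}) : set R[i] :=
  [set z | A.[z] != 0 /\
           complex.Im (B.[z] ^+ 3 / A.[z]) = 0 /\
           0 < - complex.Re (B.[z] ^+ 3 / A.[z]) < 27%:R / 4%:R].

(* Main.v *)
(* Differentiating the generating function gives a recurrence in m; with
   c = A / B^3 and H_m = (-B)^m P_m it reads
     (m+1) P_{m+1} = (m + alpha) P_m + (m - 2 + 3 alpha) c P_{m-2}.
   If Im c > 0, the recurrence keeps P_{m-2}, P_{m-1}, P_m, c P_{m-2} in
   counterclockwise order inside a half-plane, so P_m never vanishes; Im c < 0
   is the conjugate case.  If c is real and c >= -4/27, the logarithmic
   derivative of the generating function has positive coefficients, hence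
   P_m > 0.  So a zero of P_m forces c to be real and c < -4/27, for every m.
   The recurrence itself is read off along real t, where cpow has an explicit
   derivative. *)
Require Import Defs.
From mathcomp Require Import all_boot all_order all_algebra.
From mathcomp Require Import all_classical all_reals all_analysis.
From mathcomp Require Import ring lra.
Import Order.TTheory GRing.Theory Num.Theory.
Import numFieldNormedType.Exports.
Local Open Scope ring_scope.
Local Open Scope complex_scope.

Set Implicit Arguments.
Unset Strict Implicit.
Unset Printing Implicit Defensive.

(** * The recurrence with a nonreal parameter *)

(** Characterizes the Taylor coefficients of [F = (1 - s - c s^3)^(-al)], by comparing coefficients
    in [(1 - s - c s^3) F' = al (1 + 3 c s^2) F]. The first indices stand apart because [F'] and [F]
    contribute no [c] term there. *)
Definition humbert_rec (K : fieldType) (al c : K) (P : nat -> K) : Prop :=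
  [/\ P 0%N = 1, P 1%N = al, 2%:R * P 2%N = (1 + al) * P 1%N &
    forall m, m.+3%:R * P m.+3 =
      (m.+2%:R + al) * P m.+2 + c * (m%:R + 3%:R * al) * P m].

(** This is the imaginary part of [conjc y * z]: positive exactly when [z] lies counterclockwise
    from [y] by an angle strictly between 0 and pi. *)
Definition cross (R : rcfType) (y z : R[i]) : R :=
  complex.Re y * complex.Im z - complex.Im y * complex.Re z.

(** [e3] lies between [e2] and [c * e0], being a positive combination of them, and multiplication by
    [c] scales [cross e0 e1] by the squared modulus of [c]. Only [0 < cross e2 (c * e1)] needs more
    than bilinearity. *)
Lemma cross_ordered_step (R : rcfType) (a b : R) (c e0 e1 e2 : R[i]) :
  0 < a -> 0 < b -> 0 < complex.Im c ->
  0 <= cross e0 e1 -> 0 <= cross e1 e2 ->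
  0 < cross e1 (c * e0) -> 0 < cross e2 (c * e0) ->
  let e3 := a%:C * e2 + b%:C * (c * e0) in
  [/\ 0 <= cross e2 e3, 0 < cross e2 (c * e1) & 0 < cross e3 (c * e1)].
Proof.
move=> a0 b0 c0 h01 h12 h1 h2 /=.
have e1n0 : 0 < complex.Re e1 ^+ 2 + complex.Im e1 ^+ 2.
  rewrite lt_neqAle addr_ge0 ?sqr_ge0// andbT eq_sym.
  apply: contraL h1; rewrite paddr_eq0 ?sqr_ge0// !sqrf_eq0 => /andP[/eqP r /eqP i].
  by rewrite /cross r i !mul0r subr0 ltxx.
(* The Pluecker relation between e1, e2, c e0, c e1. *)
have plucker : cross e1 (c * e0) * cross e2 (c * e1) =
    cross e1 e2 * ((complex.Re c ^+ 2 + complex.Im c ^+ 2) * cross e0 e1) +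
    complex.Im c * (complex.Re e1 ^+ 2 + complex.Im e1 ^+ 2) * cross e2 (c * e0).
  by case: c e0 e1 e2 {c0 h01 h12 h1 h2 e1n0} => [? ?] [? ?] [? ?] [? ?];
    rewrite /cross /=; ring.
have h21 : 0 < cross e2 (c * e1).
  rewrite -(pmulr_rgt0 _ h1) plucker ltr_wpDl ?mulr_gt0//.
  by apply: mulr_ge0 => //; apply: mulr_ge0 => //; rewrite addr_ge0 ?sqr_ge0.
split=> //.
- suff -> : cross e2 (a%:C * e2 + b%:C * (c * e0)) = b * cross e2 (c * e0).
    by rewrite mulr_ge0 // ltW.
  by case: c e0 e2 {c0 h01 h12 h1 h2 h21 plucker} => [? ?] [? ?] [? ?];
    rewrite /cross /=; ring.
- suff -> : cross (a%:C * e2 + b%:C * (c * e0)) (c * e1) =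
     a * cross e2 (c * e1) +
     b * ((complex.Re c ^+ 2 + complex.Im c ^+ 2) * cross e0 e1).
    apply: ltr_wpDr; last exact: mulr_gt0.
    apply: mulr_ge0; first exact: ltW.
    by apply: mulr_ge0 => //; rewrite addr_ge0 ?sqr_ge0.
  by case: c e0 e1 e2 {c0 h01 h12 h1 h2 h21 e1n0 plucker}
     => [? ?] [? ?] [? ?] [? ?]; rewrite /cross /=; ring.
Qed.

(** The order is propagated by induction; its strict part [0 < cross (P m.+1) (c * P m)] is
    incompatible with [P m = 0]. *)
Lemma humbert_neq0_Im_gt0 (R : rcfType) (al : R) (c : R[i]) (P : nat -> R[i]) :
  0 < al -> 0 < complex.Im c -> humbert_rec al%:C c P -> forall m, P m != 0.
Proof.
move=> al0 c0 [P0 P1 P2 PS].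
have {}PS m : P m.+3 = ((m.+2%:R + al) / m.+3%:R)%:C * P m.+2 +
    ((m%:R + 3%:R * al) / m.+3%:R)%:C * (c * P m).
  have n0 : m.+3%:R != 0 :> R[i] by rewrite pnatr_eq0.
  apply: (mulfI n0); rewrite PS !(rmorph_nat, rmorphM, rmorphD, fmorphV).
  by move: (m.+3%:R) n0 => n3 n0; field.
have {}P2 : P 2%N = ((1 + al) * al / 2%:R)%:C.
  have n0 : 2%:R != 0 :> R[i] by rewrite pnatr_eq0.
  apply: (mulfI n0); rewrite P2 P1 !(rmorph1, rmorph_nat, rmorphM, rmorphD, fmorphV).
  by field.
have inv m : [/\ 0 <= cross (P m) (P m.+1), 0 <= cross (P m.+1) (P m.+2),
    0 < cross (P m.+1) (c * P m) & 0 < cross (P m.+2) (c * P m)].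
  elim: m => [|m [h01 h12 h1 h2]].
    (* [P 0], [P 1], [P 2] are positive reals: crosses among them vanish, and a cross with
       [c * P 0 = c] is a positive multiple of the imaginary part of [c]. *)
    have crR a b : cross (R := R) a%:C b%:C = 0 by rewrite /cross /= mulr0 mul0r subrr.
    have crc a : cross a%:C c = a * complex.Im c by rewrite /cross /= mul0r subr0.
    have a2 : 0 < (1 + al) * al / 2%:R by rewrite !(mulr_gt0, addr_gt0, invr_gt0).
    rewrite P2 P1 P0 mulr1 -[1]/(1%:C : R[i]) !crR !crc.
    by split=> //; apply: mulr_gt0.
  have a0 : 0 < (m.+2%:R + al) / m.+3%:R by rewrite divr_gt0 ?ltr0n // addr_gt0 ?ltr0n.
  have b0 : 0 < (m%:R + 3%:R * al) / m.+3%:R.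
    by rewrite divr_gt0 ?ltr0n// ltr_wpDl ?ler0n ?mulr_gt0 ?ltr0n.
  have /= [] := cross_ordered_step a0 b0 c0 h01 h12 h1 h2.
  by rewrite -PS; split.
move=> m; have [_ _ h _] := inv m.
have [Pm0|//] := eqVneq (P m) 0.
by move: h; rewrite Pm0 mulr0 /cross /= !mulr0 subr0 ltxx.
Qed.

Lemma humbert_neq0_nonreal (R : rcfType) (al : R) (c : R[i]) (P : nat -> R[i]) :
  0 < al -> complex.Im c != 0 -> humbert_rec al%:C c P -> forall m, P m != 0.
Proof.
move=> al0; rewrite neq_lt => /orP[c0|]; last exact: humbert_neq0_Im_gt0.
move=> [P0 P1 P2 PS] m; rewrite -(fmorph_eq0 (@conjc R)).
have h : 0 < complex.Im (conjc c) by case: c c0 {PS} => ? ? /=; rewrite oppr_gt0.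
have alC : (@conjc R : {rmorphism _ -> _}) al%:C = al%:C by rewrite /= oppr0.
apply: (@humbert_neq0_Im_gt0 _ _ _ (fun m => conjc (P m)) al0 h); split=> [|||k].
- by rewrite P0 rmorph1.
- by rewrite P1.
- by rewrite -[2%:R](rmorph_nat (@conjc R)) -rmorphM P2 rmorphM rmorphD rmorph1 alC.
- rewrite -[_.+3%:R](rmorph_nat (@conjc R)) -rmorphM PS.
  by rewrite !(rmorph_nat, rmorphM, rmorphD) alC.
Qed.

(** * Positivity for a real parameter *)

(* The power sums of the reciprocal zeros of [1 - s + x s^3]. *)
Fixpoint psum3 (R : pzRingType) (x : R) (k : nat) : R * R * R :=
  if k is k'.+1 then let: (p0, p1, p2) := psum3 x k' in (p1, p2, p2 - x * p0)
  else (3%:R, 1, 1).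
Definition psum (R : pzRingType) (x : R) (k : nat) : R := (psum3 x k).1.1.

Lemma psumS3 (R : pzRingType) (x : R) k : psum x k.+3 = psum x k.+2 - x * psum x k.
Proof. by rewrite /psum /=; case: psum3 => [[? ?] ?]. Qed.

Lemma psum_gt0 (R : realFieldType) (x : R) k :
  x <= 4%:R / 27%:R -> 0 < psum x k.
Proof.
move=> xle.
(* [1 - s + 4/27 s^3] has the zero 3/2 twice and the zero -3; the last
   inequality applies the factor [(E - 2/3) (E + 1/3)] of its recurrence. *)
suff [] : [/\ 0 < psum x k, 0 < psum x k.+1 &
    psum x k.+1 / 3%:R + 2%:R / 9%:R * psum x k <= psum x k.+2] by [].
elim: k => [|k [h0 h1 h2]]; first by rewrite /psum /=; split; lra.
rewrite psumS3; split=> //; first by lra.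
(* The new gap in the last inequality is 2/3 of the old gap plus [(4/27 - x) * psum x k]. *)
by nra.
Qed.

(** Coefficient form of [F' = al L F] with [F = (1 - s + x s^3)^(-al)]: factoring the cubic over its
    zeros shows that [L] is the series with coefficients [psum x k.+1]. *)
Lemma humbert_log_derivative (R : realFieldType) (al x : R) (p : nat -> R) :
  humbert_rec al (- x) p -> forall m,
  m.+1%:R * p m.+1 = al * \sum_(k < m.+1) psum x k.+1 * p (m - k)%N.
Proof.
move=> [p0 p1 p2 pS].
pose S m := \sum_(k < m.+1) psum x k.+1 * p (m - k)%N.
(* The convolution inherits the recurrence of [psum]. The leading terms leave a remainder determined
   by [psum x 0 = 3] and [psum x 1 = psum x 2 = 1]. *)
have SS m : S m.+3 = S m.+2 - x * S m + p m.+3 - 3%:R * x * p m.+1.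
  rewrite /S 3!big_ord_recl [in X in X - _ + _ - _]big_ord_recl.
  rewrite [in X in (_ + X) - _ + _ - _]big_ord_recl /= !subn0 !subSS !subn0.
  rewrite (eq_bigr (fun k : 'I_m.+1 => psum x k.+3 * p (m - k)%N -
     x * (psum x k.+1 * p (m - k)%N))); last first.
    by move=> k _; rewrite /= /bump !add1n psumS3 !subSS; ring.
  rewrite big_split sumrN -mulr_sumr /=.
  rewrite [in RHS](eq_bigr (fun k : 'I_m.+1 => psum x k.+3 * p (m - k)%N)); last first.
    by move=> k _; rewrite /= /bump !add1n !subSS.
  by rewrite /psum /=; ring.
suff H m : [/\ m.+1%:R * p m.+1 = al * S m, m.+2%:R * p m.+2 = al * S m.+1 &
    m.+3%:R * p m.+3 = al * S m.+2] by move=> m; have [] := H m.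
elim: m => [|m [h1 h2 h3]]; last first.
  split=> //; rewrite pS SS.
  have -> : m.+1%:R = m%:R + 1 :> R by rewrite -natr1.
  have e3 : m.+3%:R * p m.+3 = al * S m.+2 by [].
  have e1 : m.+1%:R * p m.+1 = al * S m by [].
  have -> : al * (S m.+2 - x * S m + p m.+3 - 3%:R * x * p m.+1) =
    al * S m.+2 - x * (al * S m) + al * p m.+3 - 3%:R * al * x * p m.+1 by ring.
  by rewrite -e3 -e1 -[m.+1%:R]natr1; ring.
move: p2 (pS 0%N); rewrite /S !big_ord_recl !big_ord0 /bump /= ?add1n.
rewrite !subn0 !subnn /psum /= p0 p1 => p2 p3.
have {}p2 : p 2%N = (1 + al) * al / 2%:R by rewrite -p2; field.
by rewrite p3 p2; split; field.
Qed.

Lemma humbert_gt0 (R : realFieldType) (al x : R) (p : nat -> R) :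
  0 < al -> x <= 4%:R / 27%:R -> humbert_rec al (- x) p -> forall m, 0 < p m.
Proof.
move=> al0 xle hp; elim/ltn_ind => -[|m] IH; first by case: hp => ->.
rewrite -(pmulr_rgt0 _ (ltr0Sn R m)) (humbert_log_derivative hp).
rewrite mulr_gt0// big_ord_recl ltr_wpDr//.
  by rewrite sumr_ge0// => i _; rewrite mulr_ge0// ltW ?psum_gt0// IH// ltnS leq_subr.
by rewrite mulr_gt0 ?psum_gt0 ?IH// ltnS leq_subr.
Qed.

(** * Zeros of the recurrence and normalization *)

Lemma humbert_root (R : rcfType) (al : R) (c : R[i]) (P : nat -> R[i]) m :
  0 < al -> humbert_rec al%:C c P -> P m = 0 ->
  complex.Im c = 0 /\ complex.Re c < - (4%:R / 27%:R).
Proof.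
move=> al0 hP Pm0.
have cr : complex.Im c = 0.
  apply/eqP; apply: contraT => c0.
  by have := humbert_neq0_nonreal al0 c0 hP m; rewrite Pm0 eqxx.
split=> //; rewrite ltNge; apply/negP => cge.
have {}cr : c = (complex.Re c)%:C by case: c cr {hP cge} => ? ? /= ->.
case: hP => P0 P1 P2 PS.
have ReM (a : R) z : complex.Re (a%:C * z) = a * complex.Re z.
  by case: z => ? ? /=; rewrite mul0r subr0.
have ReD z w : complex.Re z + complex.Re w = complex.Re (z + w) :> R.
  by case: z w => ? ? [? ?].
have natC n : n%:R = (n%:R : R)%:C by rewrite rmorph_nat.
(* With [c] real, the real parts of [P] satisfy the same recurrence over [R], so positivity applies
   with [x = - Re c]. *)
have : 0 < complex.Re (P m).
  apply: (@humbert_gt0 _ al (- complex.Re c) (fun m => complex.Re (P m)) al0).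
    by rewrite lerNl.
  rewrite opprK; split=> [|||k].
  - by rewrite P0.
  - by rewrite P1.
  - by rewrite -!ReM -natC P2 rmorphD.
  - rewrite -!ReM ReD -natC PS [in LHS]cr.
    by rewrite !(rmorph_nat, rmorphM, rmorphD).
by rewrite Pm0 ltxx.
Qed.

(** The substitution [s = - b t] turns [1 + b t + a t^3] into [1 - s - (a / b^3) s^3]. *)
Lemma humbert_rec_normalized (K : fieldType) (al a b : K) (h : nat -> K) :
  b != 0 ->
  [/\ h 0%N = 1, h 1%N = - (al * b * h 0%N),
      2%:R * h 2%N = - ((1 + al) * b * h 1%N) &
    forall m, m.+3%:R * h m.+3 =
      - ((m.+2%:R + al) * b * h m.+2) - a * (m%:R + 3%:R * al) * h m] ->
  humbert_rec al (a / b ^+ 3) (fun m => h m / (- b) ^+ m).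
Proof.
move=> b0 [h0 h1 h2 hS]; have nb0 : - b != 0 by rewrite oppr_eq0.
split=> [|||m]; first by rewrite h0 expr0 divr1.
- by rewrite h1 h0; field.
- by rewrite mulrA h2; field.
- rewrite mulrA hS !exprS; move: (_ ^+ m) (expf_neq0 m nb0) => q q0.
  by field; rewrite q0 b0.
Qed.

(** * The principal power in real coordinates *)

(** Replaces the case split in [carg] by a single differentiable formula on the right half-plane. *)
Lemma carg_atan (R : realType) (u v : R) : 0 < u -> carg (u +i* v) = atan (v / u).
Proof.
move=> u0; set y := v / u.
have hc : complex.Re (u +i* v) / cabs (u +i* v) = cos (atan y).
  rewrite cos_atan /cabs normc_def /=.
  have -> : u ^+ 2 + v ^+ 2 = u ^+ 2 * (1 + y ^+ 2) by rewrite /y; field; rewrite gt_eqF.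
  rewrite sqrtrM ?sqr_ge0// sqrtr_sqr gtr0_norm// invfM mulrA mulfV ?mul1r//.
  by rewrite gt_eqF.
have hp := @pi_gt0 R.
have h1 := atan_gtNpi2 y; have h2 := atan_ltpi2 y.
rewrite /carg hc /=; case: ifPn => [v0|].
  rewrite cosK// in_itv /=; apply/andP; split; last by lra.
  by rewrite -(@atan0 R) le_atan// /y divr_ge0// ltW.
rewrite -ltNge => v0; rewrite cosKN ?opprK//; apply/andP; split; first by lra.
by rewrite -(@atan0 R) le_atan// /y ltW// pmulr_llt0// invr_gt0.
Qed.

Lemma cpow_inv (R : realType) (u v al : R) : 0 < u ->
  (cpow (u +i* v) al)^-1 =
  (expR (- (al / 2%:R * ln (u ^+ 2 + v ^+ 2))))%:C *
    (cos (al * atan (v / u)) -i* sin (al * atan (v / u))).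
Proof.
move=> u0; rewrite /cpow /clog carg_atan// /cabs normc_def /=.
have w0 : 0 < u ^+ 2 + v ^+ 2 by rewrite ltr_wpDr ?sqr_ge0 ?exprn_gt0.
have -> : ln (Num.sqrt (u ^+ 2 + v ^+ 2)) = ln (u ^+ 2 + v ^+ 2) / 2%:R.
  have s0 : 0 < Num.sqrt (u ^+ 2 + v ^+ 2) by rewrite sqrtr_gt0.
  by have := lnXn 2 s0; rewrite sqr_sqrtr ?ltW// => ->; rewrite mulr2n; field.
rewrite /cexp [X in cos X]/= [X in sin X]/= [X in expR X]/= !mul0r subr0 addr0.
set L := _ * (_ / _); have -> : al / 2%:R * ln (u ^+ 2 + v ^+ 2) = L by rewrite /L; ring.
set T := _ * atan _; rewrite expRN invfM; congr (_ * _); first by rewrite fmorphV.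
have cs1 := cos2Dsin2 T.
apply: mulr1_eq; apply/eqP; rewrite eq_complex /=; apply/andP; split; apply/eqP.
  by rewrite -cs1; ring.
by ring.
Qed.

(** The differential equation [w F' + al w' F = 0] of [F = w^(-al)] for [w = u + i v], with [U] and
    [V] the real and imaginary parts of [F]; only real derivatives occur. *)
Lemma is_derive_cpow_inv (R : realType) (u v : R -> R) (al t du dv : R) :
  0 < u t -> is_derive t 1 u du -> is_derive t 1 v dv ->
  let G s := expR (- (al / 2%:R * ln (u s ^+ 2 + v s ^+ 2))) in
  let U s := G s * cos (al * atan (v s / u s)) in
  let V s := - (G s * sin (al * atan (v s / u s))) in
  exists dU dV,
  [/\ is_derive t 1 U dU, is_derive t 1 V dV &
   (u t +i* v t) * (dU +i* dV) + al%:C * (du +i* dv) * (U t +i* V t) = 0].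
Proof.
move=> u0 hu hv /=.
set w := (fun s => u s ^+ 2 + v s ^+ 2); set th := (fun s => atan (v s / u s)).
have w0 : 0 < w t by rewrite /w ltr_wpDr ?sqr_ge0 ?exprn_gt0.
have un0 : u t != 0 by rewrite gt_eqF.
have hw : is_derive t 1 w (2%:R * (u t * du + v t * dv)).
  have -> : w = u * u + v * v by apply/funext => s; rewrite /w !fctE !expr2.
  apply: (is_derive_eq (is_deriveD (is_deriveM hu hu) (is_deriveM hv hv))).
  by rewrite /GRing.scale /=; ring.
have hl : is_derive t 1 (fun s => - (al / 2%:R * ln (w s)))
    (- (al / w t) * (u t * du + v t * dv)).
  have h := is_derive1_comp (is_derive1_ln w0) hw.
  apply: (is_derive_eq (is_deriveN (is_deriveZ (al / 2%:R) h))).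
  by rewrite /GRing.scale /=; field; rewrite gt_eqF.
have hG := is_derive1_comp (is_derive_expR _) hl.
have hth : is_derive t 1 (fun s => al * th s) (al * (u t * dv - v t * du) / w t).
  have h := is_derive1_comp (is_derive1_atan _) (is_deriveM hv (is_deriveV un0 hu)).
  apply: (is_derive_eq (is_deriveZ al h)).
  rewrite /GRing.scale /= -[(v * _) t]/(v t / u t) /w.
  by field; rewrite un0 (gt_eqF w0).
have hU := is_deriveM hG (is_derive1_comp (is_derive_cos _) hth).
have hV := is_deriveN (is_deriveM hG (is_derive1_comp (is_derive_sin _) hth)).
eexists; eexists; split; [exact: hU|exact: hV|].
rewrite /= /GRing.scale /= -[u t ^+ 2 + v t ^+ 2]/(w t) -[atan (v t / u t)]/(th t).
move: (expR _) (cos _) (sin _) => E C S.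
apply/eqP; rewrite eq_complex /=; have := gt_eqF w0; rewrite /w => w0'.
by apply/andP; split; apply/eqP; field; rewrite w0'.
Qed.

(** * Differentiation and uniqueness of real power series *)

(** Convergence at [K] bounds the terms [c n * K ^ n], so at [K / 4] a geometric series of ratio 1/2
    dominates the differentiated one. *)
Lemma is_cvg_pseries_diffs (R : realType) (c : nat -> R) (K : R) :
  0 < K -> cvgn (pseries c K) -> cvgn (pseries (pseries_diffs c) (K / 4%:R)).
Proof.
move=> K0 /cvg_series_bounded [M [_ Mc]].
have {}Mc n : `|c n * K ^+ n| <= `|M + 1|.
  by apply: Mc => //; rewrite (lt_le_trans _ (ler_norm _))// ltrDl.
apply: normed_cvg.
apply: (@series_le_cvg _ _ (geometric (`|M + 1| / K) 2^-1)) => [n|n|n|].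
- by rewrite normr_ge0.
- by rewrite /geometric /= mulr_ge0 ?exprn_ge0// divr_ge0// ltW.
- rewrite /geometric /= /pseries_diffs.
  have -> : n.+1%:R * c n.+1 * (K / 4) ^+ n =
      (c n.+1 * K ^+ n.+1) * (n.+1%:R / 2 ^+ n) * (2^-1 ^+ n / K).
    have -> : 4 = 2 * 2 :> R by ring.
    by rewrite !exprMn !exprVn exprMn exprS; field;
       rewrite !expf_neq0 ?pnatr_eq0// gt_eqF.
  (* [n + 1 <= 2 ^ n] pays for the differentiation by halving the radius. *)
  have -> : `|M + 1| / K * 2^-1 ^+ n = `|M + 1| * (1 * (2^-1 ^+ n / K)) by ring.
  rewrite -mulrA normrM [`|_ / _ * _|]normrM.
  apply: ler_pM; rewrite ?mulr_ge0//; apply: ler_pM; rewrite ?mulr_ge0//.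
    rewrite !ger0_norm ?invr_ge0 ?exprn_ge0// ler_pdivrMr ?exprn_gt0//.
    by rewrite mul1r -natrX ler_nat ltn_expl.
  by rewrite ger0_norm// divr_ge0 ?exprn_ge0 ?invr_ge0// ltW.
- apply: is_cvg_geometric_series.
  by rewrite ger0_norm ?invr_ge0// invf_lt1// ltr1n.
Qed.

(** The constant 32 is 2 * 4 * 4: the series converges at [r / 2], and each of the two formal
    derivatives required by [pseries_snd_diffs] costs a factor 4. *)
Lemma pseries_sum_derive (R : realType) (c : nat -> R) (f : R -> R) (r : R) :
  0 < r -> (forall t : R, `|t| < r -> (pseries c t @ \oo --> f t)%classic) ->
  forall t : R, `|t| < r / 32%:R ->
    exists2 df : R, is_derive t 1 f df & (pseries (pseries_diffs c) t @ \oo --> df)%classic.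
Proof.
move=> r0 hf t ht.
have hr : 0 < r / 2 by lra.
have c0 : cvgn (pseries c (r / 2)).
  by apply/cvg_ex; exists (f (r / 2)); apply: hf; rewrite gtr0_norm //; lra.
have c1 := is_cvg_pseries_diffs hr c0.
have hr1 : 0 < r / 2 / 4 by lra.
have c2 := is_cvg_pseries_diffs hr1 c1.
have nK : `|r / 2 / 4 / 4| = r / 32.
  have -> : r / 2 / 4 / 4 = r / 32 by field.
  by rewrite gtr0_norm// divr_gt0.
have h := pseries_snd_diffs (K := r / 2 / 4 / 4) (x := t) _ _ c2.
exists (limn (pseries (pseries_diffs c) t)); last first.
  by apply: (is_cvg_pseries_inside c1); rewrite (gtr0_norm hr1); lra.
(* [f] is known to be the sum only for arguments of modulus below [r], hence near [t], which
   suffices for the derivative. *)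
apply: near_eq_is_derive; last apply: h.
- have : \forall s \near t, `|s| < r.
    have tr : `|t| < r by lra.
    exact: (@cvgr_norm_lt _ _ _ (nbhs t) _ id t (@cvg_id _ _) _ tr).
  apply: filterS => s hs; apply/cvg_lim => //; exact: hf.
- by apply: (is_cvg_pseries_inside c0); rewrite nK gtr0_norm//; lra.
- by apply: (is_cvg_pseries_inside c1); rewrite nK gtr0_norm//; lra.
- by rewrite nK.
Qed.

Lemma pseries_cvg0 (R : realType) (c : nat -> R) : (pseries c 0 @ \oo --> c 0%N)%classic.
Proof.
apply/cvg_ballP => e e0.
exists 1%N => // -[//|k] _; rewrite /pseries /series /= big_nat_recl//= expr0 mulr1.
rewrite big1 ?addr0; first exact: ballxx.
by move=> i _; rewrite exprS mul0r mulr0.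
Qed.

(** The value at 0 gives the constant coefficient; differentiating lowers the index. The induction
    generalizes over [c] and [r], since each derivative changes both. *)
Lemma pseries_sum_eq0 (R : realType) (c : nat -> R) (r : R) : 0 < r ->
  (forall t : R, `|t| < r -> (pseries c t @ \oo --> (0 : R))%classic) ->
  forall n, c n = 0.
Proof.
move=> + + n; elim: n c r => [|n IH] c r r0 hc.
  have := hc 0; rewrite normr0 => /(_ r0) hc0.
  exact: (@cvg_unique R (@norm_hausdorff _ R) _ _ _ _ (@pseries_cvg0 _ c) hc0).
suff : pseries_diffs c n = 0.
  by rewrite /pseries_diffs => /eqP; rewrite mulf_eq0 pnatr_eq0 => /eqP.
apply: (IH _ (r / 32)) => [|t ht]; first by rewrite divr_gt0.
have [df hd] := pseries_sum_derive (f := fun=> 0) r0 hc ht.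
suff -> : df = 0 by [].
by rewrite -(@derive_val _ _ _ _ _ _ _ hd) derive_cst.
Qed.

(** * Series with complex coefficients along the real line *)

Lemma cvg_complexP (R : realType) (T : Type) (F : set_system T) (FF : Filter F)
    (u : T -> R[i]) (l : R[i]) :
  (u x @[x --> F] --> (l : R[i]^o))%classic <->
  (complex.Re (u x) @[x --> F] --> complex.Re l)%classic /\
  (complex.Im (u x) @[x --> F] --> complex.Im l)%classic.
Proof.
have nE (z : R[i]) : `|z| = (Num.sqrt (complex.Re z ^+ 2 + complex.Im z ^+ 2))%:C.
  exact: normc_def.
split=> [hu|[hr hi]].
  have {}hu := (@cvgrPdist_lt _ (R[i]^o) _ _ FF u l).1 hu.
  split; apply/(@cvgrPdist_lt _ R) => e e0.
    have e0' : 0 < e%:C :> R[i] by rewrite ltcR.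
    have := hu _ e0'; apply: filterS => x; rewrite nE ltcR; apply: le_lt_trans.
    rewrite -sqrtr_sqr ler_wsqrtr//; case: (u x) l {hu} => [? ?] [? ?] /=.
    by rewrite lerDl sqr_ge0.
  have e0' : 0 < e%:C :> R[i] by rewrite ltcR.
  have := hu _ e0'; apply: filterS => x; rewrite nE ltcR; apply: le_lt_trans.
  rewrite -sqrtr_sqr ler_wsqrtr//; case: (u x) l {hu} => [? ?] [? ?] /=.
  by rewrite lerDr sqr_ge0.
have {}hr := (@cvgrPdist_lt _ R _ _ FF _ _).1 hr.
have {}hi := (@cvgrPdist_lt _ R _ _ FF _ _).1 hi.
apply/(@cvgrPdist_lt _ (R[i]^o) _ _ FF u l) => e; rewrite ltcE /= => /andP[/eqP ei er].
have -> : e = (complex.Re e)%:C by case: e ei er => ? ? /= -> _.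
have e20 : 0 < complex.Re e / 2 by rewrite divr_gt0.
have := @filterI _ F FF _ _ (hr _ e20) (hi _ e20).
apply: filterS => x [/= h1 h2].
rewrite nE ltcR.
have -> : complex.Re (l - u x) = complex.Re l - complex.Re (u x).
  by case: (u x) l {hr hi h1 h2} => [? ?] [? ?].
have -> : complex.Im (l - u x) = complex.Im l - complex.Im (u x).
  by case: (u x) l {hr hi h1 h2} => [? ?] [? ?].
move: h1 h2; move: (_ - _) (_ - _) => p q h1 h2.
rewrite -(gtr0_norm er) -sqrtr_sqr ltr_sqrt ?exprn_gt0//.
rewrite -[p ^+ 2]real_normK ?num_real// -[q ^+ 2]real_normK ?num_real//.
by have := normr_ge0 p; have := normr_ge0 q; nra.
Qed.

Lemma cvg_series_lin (K : numFieldType) (f g : nat -> K) (k x y : K) :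
  (series f @ \oo --> (x : K^o))%classic -> (series g @ \oo --> (y : K^o))%classic ->
  (series (fun n => k * f n + g n) @ \oo --> (k * x + y : K^o))%classic.
Proof.
move=> hf hg.
have -> : series (fun n => k * f n + g n) = (fun n => k *: (series f n : K^o) + series g n).
  by apply/funext => n; rewrite /series /= big_split/= -mulr_sumr.
by apply: (@cvgD _ K^o) => //; apply: (@cvgZl_tmp _ K^o).
Qed.

Definition shift_coef (K : pzRingType) (h : nat -> K) (n : nat) : K :=
  if n is n'.+1 then h n' else 0.

Lemma cvg_series_shift (K : numFieldType) (h : nat -> K) (t x : K) :
  (series (fun n => h n * t ^+ n) @ \oo --> (x : K^o))%classic ->
  (series (fun n => shift_coef h n * t ^+ n) @ \oo --> (t * x : K^o))%classic.
Proof.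
move=> hf; rewrite -cvg_shiftS.
have -> : [sequence series (fun n => shift_coef h n * t ^+ n) n.+1]_n =
    (fun n => t *: (series (fun n => h n * t ^+ n) n : K^o)).
  apply/funext => n; rewrite /series /= big_nat_recl//= mul0r add0r /GRing.scale /=.
  by rewrite mulr_sumr; apply: eq_bigr => i _; rewrite exprS; ring.
by apply: (@cvgZl_tmp _ K^o).
Qed.

Lemma complex_series_real (R : realType) (h : nat -> R[i]) (t : R) (l : R[i]) :
  (series (fun n => h n * t%:C ^+ n) @ \oo --> (l : R[i]^o))%classic <->
  (pseries (fun n => complex.Re (h n)) t @ \oo --> complex.Re l)%classic /\
  (pseries (fun n => complex.Im (h n)) t @ \oo --> complex.Im l)%classic.
Proof.
have E n : h n * t%:C ^+ n = (complex.Re (h n) * t ^+ n) +i* (complex.Im (h n) * t ^+ n).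
  rewrite -rmorphXn; case: (h n) => p q; apply/eqP.
  by rewrite eq_complex /= !mulr0 subr0 add0r !eqxx.
have -> : pseries (fun n => complex.Re (h n)) t =
    (fun n => complex.Re (series (fun n => h n * t%:C ^+ n) n)).
  apply/funext => n; rewrite /pseries /series /=.
  elim/big_ind2: _ => //= [x1 x2 y1 y2 -> ->|i _]; last by rewrite E.
  by case: x1 y1 => [? ?] [? ?].
have -> : pseries (fun n => complex.Im (h n)) t =
    (fun n => complex.Im (series (fun n => h n * t%:C ^+ n) n)).
  apply/funext => n; rewrite /pseries /series /=.
  elim/big_ind2: _ => //= [x1 x2 y1 y2 -> ->|i _]; last by rewrite E.
  by case: x1 y1 => [? ?] [? ?].
exact: cvg_complexP.
Qed.

Lemma complex_series_eq0 (R : realType) (d : nat -> R[i]) (r : R) : 0 < r ->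
  (forall t : R, `|t| < r ->
    (series (fun n => d n * t%:C ^+ n) @ \oo --> (0 : R[i]^o))%classic) ->
  forall n, d n = 0.
Proof.
move=> r0 hd n; apply/eqP; rewrite eq_complex; apply/andP; split; apply/eqP.
  apply: (@pseries_sum_eq0 _ (fun n => complex.Re (d n)) r) => // t /hd.
  by case/complex_series_real.
apply: (@pseries_sum_eq0 _ (fun n => complex.Im (d n)) r) => // t /hd.
by case/complex_series_real.
Qed.

Lemma complex_series_derive (R : realType) (h : nat -> R[i]) (G : R -> R[i]) (r : R) :
  0 < r ->
  (forall t : R, `|t| < r ->
    (series (fun n => h n * t%:C ^+ n) @ \oo --> (G t : R[i]^o))%classic) ->
  forall t : R, `|t| < r / 32 ->
  exists dU dV : R,
  [/\ is_derive t 1 (fun s => complex.Re (G s)) dU,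
      is_derive t 1 (fun s => complex.Im (G s)) dV &
    (series (fun n => (n.+1%:R * h n.+1) * t%:C ^+ n) @ \oo
       --> (dU +i* dV : R[i]^o))%classic].
Proof.
move=> r0 hG t ht.
have [s /hG /complex_series_real[]//|dU hU hdU] :=
  @pseries_sum_derive _ (fun n => complex.Re (h n)) (fun s => complex.Re (G s)) r r0 _ t ht.
have [s /hG /complex_series_real[]//|dV hV hdV] :=
  @pseries_sum_derive _ (fun n => complex.Im (h n)) (fun s => complex.Im (G s)) r r0 _ t ht.
exists dU, dV; split=> //; apply/complex_series_real; split=> /=.
  suff -> : (fun n => complex.Re (n.+1%:R * h n.+1)) =
    pseries_diffs (fun n => complex.Re (h n)) by [].
  apply/funext => n; rewrite /pseries_diffs -(rmorph_nat (real_complex R)).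
  by case: (h n.+1) => ? ?; rewrite [LHS]/= mul0r subr0.
suff -> : (fun n => complex.Im (n.+1%:R * h n.+1)) =
  pseries_diffs (fun n => complex.Im (h n)) by [].
apply/funext => n; rewrite /pseries_diffs -(rmorph_nat (real_complex R)).
by case: (h n.+1) => ? ?; rewrite [LHS]/= mul0r addr0.
Qed.

(** * From the generating function to the recurrence *)

Lemma is_derive_cubic (R : realType) (k c d t : R) :
  is_derive t 1 (fun s => k + c * s + d * s ^+ 3) (c + 3%:R * d * t ^+ 2).
Proof.
have h1 := is_deriveZ c (is_derive_id t (1 : R)).
have h3 := is_deriveZ d (is_deriveX 3 (is_derive_id t (1 : R))).
have -> : (fun s => k + c * s + d * s ^+ 3) = cst k + c *: id + d *: id ^+ 3.
  by apply/funext => s; rewrite !fctE.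
apply: (is_derive_eq (is_deriveD (is_deriveD (is_derive_cst k t 1) h1) h3)).
by rewrite /GRing.scale /=; ring.
Qed.

(** For real [t] near 0 the differential equation of the power becomes a power series with sum 0;
    its coefficients vanish by uniqueness, which is the recurrence. *)
Lemma cpow_coef_rec (R : realType) (al : R) (a b : R[i]) (h : nat -> R[i]) :
  (\forall t \near (0 : R[i]^o), series (fun m => h m * t ^+ m) @ \oo -->
      ((cpow (1 + b * t + a * t ^+ 3) al)^-1 : R[i]^o))%classic ->
  [/\ h 0%N = 1, h 1%N = - (al%:C * b * h 0%N),
      2%:R * h 2%N = - ((1 + al%:C) * b * h 1%N) &
    forall m, m.+3%:R * h m.+3 =
      - ((m.+2%:R + al%:C) * b * h m.+2) - a * (m%:R + 3%:R * al%:C) * h m].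
Proof.
move=> hh.
set u := fun t : R => 1 + complex.Re b * t + complex.Re a * t ^+ 3.
set v := fun t : R => complex.Im b * t + complex.Im a * t ^+ 3.
have uvE (t : R) : 1 + b * t%:C + a * t%:C ^+ 3 = u t +i* v t.
  rewrite -rmorphXn /u /v; case: (a) (b) => ? ? [? ?]; apply/eqP.
  by rewrite eq_complex /= !mulr0 !subr0 !add0r !eqxx.
have [r r0 hr] : exists2 r : R, 0 < r & forall t : R, `|t| < r -> 0 < u t /\
   (series (fun m => h m * t%:C ^+ m) @ \oo -->
      ((cpow (u t +i* v t) al)^-1 : R[i]^o))%classic.
  have c0 : (t%:C @[t --> (0 : R)] --> (0 : R[i]^o))%classic.
    by apply/cvg_complexP; split=> /=; [exact: cvg_id|exact: cvg_cst].
  (* Positivity of the real part [u] keeps the base in the half-plane where the [atan] formula for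
     the argument is valid. *)
  have hu : \forall t \near (0 : R), 0 < u t.
    suff hu : (u s @[s --> (0 : R)] --> (1 : R))%classic.
      by apply: (@cvgr_gt _ _ (nbhs (0 : R)) _ u 1 hu).
    have -> : 1 = u 0 by rewrite /u expr0n !mulr0 !addr0.
    by apply: cvgD; [apply: cvgD; [exact: cvg_cst|apply: cvgMl_tmp; exact: cvg_id]
      |apply: cvgMl_tmp; apply: exprn_continuous].
  have hc : \forall t \near (0 : R), (series (fun m => h m * t%:C ^+ m) @ \oo -->
      ((cpow (1 + b * t%:C + a * t%:C ^+ 3) al)^-1 : R[i]^o))%classic.
    exact: (c0 _ hh).
  have [r /= r0 hr] := (@nbhs_ballP R R 0 _).1 (filterI hu hc).
  exists r; first exact: r0.
  move=> t tr; have tb : ball (0 : R) r t by rewrite /ball /= sub0r normrN.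
  by have [u0 ht] := hr t tb; split; [exact: u0|rewrite -uvE; exact: ht].
have h0 : h 0%N = 1.
  have := hr 0; rewrite normr0 => /(_ r0) [u00]; rewrite cpow_inv// {u00}.
  rewrite /u /v !expr0n !mulr0 !addr0 expr1n expr0n addr0 ln1 mul0r atan0 !mulr0.
  rewrite oppr0 expR0 cos0 sin0 oppr0 mulr1 => /complex_series_real[hR hI].
  apply/eqP; rewrite eq_complex; apply/andP; split; apply/eqP.
    exact: (@cvg_unique _ (@norm_hausdorff _ R) _ _ _ _
      (@pseries_cvg0 _ (fun n => complex.Re (h n))) hR).
  exact: (@cvg_unique _ (@norm_hausdorff _ R) _ _ _ _
    (@pseries_cvg0 _ (fun n => complex.Im (h n))) hI).
pose D n := n.+1%:R * h n.+1.
(* [D] lists the coefficients of [G'], and [d] those of [(1 + b t + a t^3) G' + al (b + 3 a t^2)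
   G]. *)
pose d n := D n + b * shift_coef D n + a * shift_coef (shift_coef (shift_coef D)) n
  + al%:C * b * h n + 3%:R * al%:C * a * shift_coef (shift_coef h) n.
have d0 n : d n = 0.
  apply: (@complex_series_eq0 _ d (r / 32)) => [|t ht]; first by rewrite divr_gt0.
  have tr : `|t| < r by lra.
  have [u0 _] := hr t tr.
  have du : is_derive t 1 u (complex.Re b + 3%:R * complex.Re a * t ^+ 2).
    exact: is_derive_cubic.
  have dv : is_derive t 1 v (complex.Im b + 3%:R * complex.Im a * t ^+ 2).
    have -> : v = (fun s => 0 + complex.Im b * s + complex.Im a * s ^+ 3).
      by apply/funext => s; rewrite add0r.
    exact: is_derive_cubic.
  have /= [dU [dV [hU hV]]] := is_derive_cpow_inv al u0 du dv.
  set G := fun s => expR (- (al / 2%:R * ln (u s ^+ 2 + v s ^+ 2))).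
  set th := fun s => al * atan (v s / u s).
  have hG s : `|s| < r -> (series (fun m => h m * s%:C ^+ m) @ \oo -->
      ((G s * cos (th s)) -i* (G s * sin (th s)) : R[i]^o))%classic.
    move=> sr; have [us] := hr s sr; rewrite (cpow_inv (v s) al us).
    have -> : (G s)%:C * (cos (th s) -i* sin (th s)) =
      (G s * cos (th s)) -i* (G s * sin (th s)); last by apply.
    by apply/eqP; rewrite eq_complex /= !mul0r subr0 addr0 mulrN !eqxx.
  have [dU' [dV' /= [hU' hV' hS]]] := complex_series_derive r0 hG ht.
  (* The termwise derivative and the closed-form derivative are derivatives of the same functions,
     so they agree. *)
  have eU : dU' = dU by have [_ <-] := hU'; have [_ <-] := hU.
  have eV : dV' = dV by have [_ <-] := hV'; have [_ <-] := hV.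
  rewrite {}eU {}eV {hU' hV'} in hS => hode.
  have hD := cvg_series_shift hS.
  have hDDD := cvg_series_shift (cvg_series_shift hD).
  have hhh := cvg_series_shift (cvg_series_shift (hG t tr)).
  have := @cvg_series_lin _ _ _ (3%:R * al%:C * a) _ _ hhh
    (@cvg_series_lin _ _ _ (al%:C * b) _ _ (hG t tr)
    (@cvg_series_lin _ _ _ a _ _ hDDD (@cvg_series_lin _ _ _ b _ _ hD hS))).
  set l := (X in (_ --> X)%classic -> _); set f := fun n => _.
  have -> : l = 0.
    rewrite -[RHS]hode -uvE /l.
    have -> : (complex.Re b + 3%:R * complex.Re a * t ^+ 2) +i*
      (complex.Im b + 3%:R * complex.Im a * t ^+ 2) = b + 3%:R * a * t%:C ^+ 2.
      rewrite -rmorphXn -[3%:R in RHS](rmorph_nat (real_complex R)).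
      case: (a) (b) => ? ? [? ?]; apply/eqP.
      by rewrite eq_complex /= !mulr0 !mul0r !subr0 !addr0 ?add0r !eqxx.
    rewrite -/(th t) -/(G t). ring.
  suff -> : f = (fun n => d n * t%:C ^+ n) by [].
  by apply/funext => n'; rewrite /f /d /D; ring.
split=> //.
- have := d0 0%N; rewrite /d /D /= !mulr0 !addr0 mul1r => /eqP.
  by rewrite addr_eq0 => /eqP.
- have := d0 1%N; rewrite /d /D /= !mulr0 !addr0 mul1r => /eqP.
  by rewrite -addrA addr_eq0 => /eqP ->; ring.
- move=> m; apply/eqP; rewrite -subr_eq0 -(d0 m.+2) /d; apply/eqP.
  (* At [m = 0] the default value 0 of the shift agrees with [0 * h 0]. *)
  have -> : shift_coef (shift_coef (shift_coef D)) m.+2 = m%:R * h m.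
    by case: m => [|m]; rewrite ?mul0r.
  rewrite -[shift_coef D _]/(D m.+1) -[shift_coef (shift_coef h) _]/(h m) /D.
  by ring.
Qed.

(** * Location of the zeros *)

Unset Implicit Arguments.

Theorem theorem1 (R : realType) (alpha : R) (A B : {poly R[i]})
    (H : nat -> {poly R[i]}) (alpha_gt0 : 0 < alpha)
    (HH : generated_by alpha A B H) :
  exists M : nat, forall m : nat, (M <= m)%N ->
    forall z : R[i], root (H m) z -> B.[z] != 0 -> root_curve A B z.
Proof.
exists 0%N => m _ z /rootP Hz Bz.
have hP := humbert_rec_normalized Bz (cpow_coef_rec (HH z)).
have [|ci cr] := humbert_root (m := m) alpha_gt0 hP; first by rewrite Hz mul0r.
have {ci}cE : A.[z] / B.[z] ^+ 3 = (complex.Re (A.[z] / B.[z] ^+ 3))%:C.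
  by case: (_ / _) ci {cr hP} => ? ? /= ->.
move: (complex.Re _) cr cE => c clt cE.
have c0 : c < 0 by apply: (lt_trans clt); rewrite oppr_lt0 divr_gt0.
(* The root lemma locates [c = A / B^3], while the curve is stated for its reciprocal: [c < - 4/27]
   becomes [0 < - c^-1 < 27/4]. *)
have BA : B.[z] ^+ 3 / A.[z] = (c^-1)%:C by apply: invr_inj; rewrite invf_div cE fmorphV invrK.
split; last rewrite BA /=; last split=> //.
  (* If [A] vanished at [z], then [c] would be 0, contradicting [c < 0]. *)
  apply: contraTneq c0 => A0; move: cE; rewrite A0 mul0r.
  move=> /(congr1 (@complex.Re R)) /= <-.
  by rewrite ltxx.
rewrite oppr_gt0 invr_lt0 c0 /= -invrN -[X in _ < X]invrK.
rewrite ltf_pV2 ?posrE ?invr_gt0 ?oppr_gt0 ?divr_gt0// invf_div.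
by rewrite ltrNr.
Qed.
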